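(* Let $n\ge 4$ and let $p$ be an integer with $(n-1)(n-3)\le p\le \frac{n!-2}{2}$. Then there exists a symmetric set $S\subseteq S_n$ with $|S|=p$ such that $\iota_n\notin S$ and $\delta_n\notin S$.
   Context: $S_n$ is the symmetric group on $[n]=\{1,\dots,n\}$; permutations are written in one-line notation. For $w\in S_n$, $\mathrm{Des}(w)=\{i\in[n-1] : w(i)>w(i+1)\}$. For $D\subseteq[n-1]$, Gessel's fundamental quasisymmetric function is $F_{n,D}=\sum x_{i_1}x_{i_2}\cdots x_{i_n}$, the sum over all $i_1\le i_2\le\cdots\le i_n$ (positive integers) with $i_j<i_{j+1}$ whenever $j\in D$. For $S\subseteq S_n$, $Q(S)=\sum_{w\in S}F_{n,\mathrm{Des}(w)}$. The set $S$ is called symmetric if $Q(S)$ is a symmetric function. The monotone elements are $\iota_n=12\cdots n$ and $\delta_n=n(n-1)\cdots 1$. *)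

(* Defs.v *)
From mathcomp Require Import all_boot all_order all_fingroup.
Set Implicit Arguments. Unset Strict Implicit. Unset Printing Implicit Defensive.

(* Permutations of [n] are {perm 'I_n}; position i (0-indexed) stands for i+1.
   One-line notation: w(i) = w i. *)

Definition Des n (w : {perm 'I_n}) : pred nat :=
  fun i => [exists j : 'I_n, exists k : 'I_n,
             [&& val j == i, val k == i.+1 & w k < w j]].

(* Coefficient of the monomial x_1^{a_1} ... x_N^{a_N} (variables indexed by
   'I_N) in Gessel's F_{n,D}: the number of weakly increasing sequences
   i_1 <= ... <= i_n (values in 'I_N) with i_j < i_{j+1} for j in D,
   whose content is a. *)
Definition Fcoef n (D : pred nat) N (a : 'I_N -> nat) : nat :=
  #|[set f : {ffun 'I_n -> 'I_N} |
      [forall j : 'I_n, forall k : 'I_n,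
         (val k == j.+1) ==> ((f j <= f k) && (D (val j) ==> (f j < f k)))]
      && [forall m : 'I_N, #|[set j | f j == m]| == a m]]|.

Definition Qcoef n (S : {set {perm 'I_n}}) N (a : 'I_N -> nat) : nat :=
  \sum_(w in S) @Fcoef n (Des w) N a.

(* Q(S) is a symmetric function: its coefficients are invariant under
   every permutation of the variables (every monomial involves finitely many
   variables, so it suffices to consider x_1..x_N for all N). *)
Definition symmetric_set n (S : {set {perm 'I_n}}) : Prop :=
  forall N (a : 'I_N -> nat) (s : {perm 'I_N}),
    Qcoef S a = Qcoef S (fun m => a (s m)).

Definition delta n : {perm 'I_n} := perm (@rev_ord_inj n).

(* Main.v *)
Require Import Defs.
From mathcomp Require Import all_boot all_order all_fingroup.
From mathcomp Require Import zify.

(* Only the numbers c(D) of elements of S with descent set D matter: any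
   symmetric vector c with 0 <= c(D) <= beta(D), where beta(D) is the number of
   permutations with descent set D, comes from a symmetric set of size sum c.
   Hooks, s_(n-2,2), and X = s_(n-1,1) + s_(n-2,1,1) - s_(n-2,2) give such
   vectors; X is F-positive, equal to F_1 + F_(n-1) + sum_i F_(i,i+1), of size n.
     For p of order at most n^3, combine copies of X (size n), of s_(n-1,1) and
   s_(2,1^(n-2)) (size n-1), and of s_(3,1^(n-3)); the single value
   p = (n-1)(n-2) - 1 needs s_(n-2,2) + s_(n-2,1,1) instead.
     For larger p argue by induction on n, keeping all n-1 copies of s_(n-1,1)
   unused. Multiplying by h_1 a vector for n-1 multiplies its size by n and
   leaves unused n-2 copies each of s_(n-2,1,1) and s_(n-2,2), whose sizes differ
   by 1, together with a copy of s_(2,1^(n-2)); these reach all residues of p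
   modulo n. The values of p below the range of this step are obtained directly
   from hooks and s_(n-2,2). *)

(** * Vectors of coefficients on fundamental quasisymmetric functions *)

(* A vector c : bitseq -> nat stands for the sum of the c(D) F_{n,D}, where D is
   encoded by n-1 bits; [coefF c E] is the sum of c(D) over the subsets D of E,
   which is the coefficient of any monomial whose exponents have the partial sums
   E. *)
Fixpoint coefF (c : bitseq -> nat) (E : bitseq) : nat :=
  if E is e :: E1 then
    coefF (fun u => c (false :: u)) E1 + e * coefF (fun u => c (true :: u)) E1
  else c [::].

(* [mulh1] is multiplication by h_1: its coefficient at D collects c over the
   descent sets that yield D when a new largest letter is inserted. In front, the
   letter adds an initial 1 to D, at the end a final 0; inside, it replaces an
   arbitrary bit by 01. *)
Fixpoint mulh1_tail (c : bitseq -> nat) (D : bitseq) : nat :=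
  if D is b :: D1 then
    (if D1 is b1 :: D2 then (~~ b && b1) * (c (false :: D2) + c (true :: D2))
     else ~~ b * c [::])
    + mulh1_tail (fun u => c (b :: u)) D1
  else 0.

Definition mulh1 (c : bitseq -> nat) (D : bitseq) : nat :=
  (if D is b :: D1 then b * c D1 else 0) + mulh1_tail c D.

Lemma eq_coefF c c' E :
  (forall D, size D = size E -> c D = c' D) -> coefF c E = coefF c' E.
Proof.
elim: E c c' => [|e E IH] c c' eqc /=; first exact: eqc.
by congr (_ + _ * _); apply: IH => D sD; apply: eqc; rewrite /= sD.
Qed.

Lemma coefFD c c' E : coefF (fun D => c D + c' D) E = coefF c E + coefF c' E.
Proof.
by elim: E c c' => [|e E IH] c c' //=; rewrite !IH mulnDr addnACA.
Qed.

Lemma coefFZ m c E : coefF (fun D => m * c D) E = m * coefF c E.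
Proof. by elim: E c => [|e E IH] c //=; rewrite !IH mulnDr mulnCA. Qed.

Lemma coefF0 E : coefF (fun=> 0) E = 0.
Proof. by rewrite (coefFZ 0 (fun=> 0)). Qed.

Lemma coefF_sum (I : finType) (P : pred I) (f : I -> bitseq -> nat) E :
  coefF (fun D => \sum_(i | P i) f i D) E = \sum_(i | P i) coefF (f i) E.
Proof.
elim: E f => [|e E IH] f //=.
by rewrite !IH big_distrr -big_split.
Qed.

(** This is the vector of a single F_{n,D0}; [all2 implb] is inclusion of sets. *)
Lemma coefF_pred1 D0 E : size D0 = size E ->
  coefF (fun D => D0 == D) E = all2 implb D0 E.
Proof.
elim: E D0 => [|e E IH] [|b D] //= [sD].
have eqF x : coefF (fun u => b :: D == x :: u) E = (b == x) * (all2 implb D E).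
  rewrite -IH // -coefFZ; apply: eq_coefF => u _.
  by case: b x => [] []; rewrite ?mul0n ?mul1n.
by rewrite !eqF; case: b e {eqF} => [] [] /=; lia.
Qed.

Lemma mulh1_tail_le c c' D :
  (forall u, size u = (size D).-1 -> c u <= c' u) ->
  mulh1_tail c D <= mulh1_tail c' D.
Proof.
elim: D c c' => [|b D IH] c c' //= lec.
apply: leq_add; last first.
  case: D IH lec => [|b1 D] IH lec //.
  by apply: IH => u su; apply: lec; rewrite /= su.
case: D {IH} lec => [|b1 D] lec; rewrite leq_mul //; first exact: lec.
by apply: leq_add; apply: lec.
Qed.

(** As [beta k.+1] is [mulh1 (beta k)], monotonicity carries bounds by [beta] from n - 1 to n. *)
Lemma mulh1_le k c c' D : size D = k.+1 ->
  (forall u, size u = k -> c u <= c' u) -> mulh1 c D <= mulh1 c' D.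
Proof.
move=> sD lec; rewrite /mulh1; apply: leq_add.
  by case: D sD => [|b D] //= [sD]; rewrite leq_mul // lec.
by apply: mulh1_tail_le => u su; apply: lec; rewrite su sD.
Qed.

Lemma mulh1_tailD c c' D :
  mulh1_tail (fun u => c u + c' u) D = mulh1_tail c D + mulh1_tail c' D.
Proof.
elim: D c c' => [|b D IH] c c' //=; rewrite IH.
by case: D {IH} => [|b1 D]; rewrite [RHS]addnACA -mulnDr // (addnACA (c _)).
Qed.

Lemma mulh1D c c' D : mulh1 (fun u => c u + c' u) D = mulh1 c D + mulh1 c' D.
Proof.
rewrite /mulh1 mulh1_tailD; case: D => [|b D] //.
by rewrite mulnDr addnACA.
Qed.

Lemma mulh1_tail0 D : mulh1_tail (fun=> 0) D = 0.
Proof.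
elim: D => [|b D IH] //=; rewrite IH.
by case: D {IH} => [|b1 D]; rewrite muln0.
Qed.

Lemma mulh1_0 D : mulh1 (fun=> 0) D = 0.
Proof. by rewrite /mulh1 mulh1_tail0; case: D => // b D; rewrite muln0. Qed.

Lemma eq_mulh1_tail c c' D : c =1 c' -> mulh1_tail c D = mulh1_tail c' D.
Proof.
move=> eqc; apply/eqP; rewrite eqn_leq.
by apply/andP; split; apply: mulh1_tail_le => u _; rewrite eqc.
Qed.

Lemma eq_mulh1 c c' D : c =1 c' -> mulh1 c D = mulh1 c' D.
Proof.
by move=> eqc; rewrite /mulh1 (eq_mulh1_tail _ _ D eqc); case: D => // b D; rewrite eqc.
Qed.

Lemma mulh1_sum (I : Type) (r : seq I) (f : I -> bitseq -> nat) D :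
  mulh1 (fun u => \sum_(i <- r) f i u) D = \sum_(i <- r) mulh1 (f i) D.
Proof.
elim: r => [|i r IH].
  by rewrite big_nil -[RHS](mulh1_0 D); apply: eq_mulh1 => u; rewrite big_nil.
rewrite big_cons -IH -mulh1D; apply: eq_mulh1 => u.
by rewrite big_cons.
Qed.

(* On the side of compositions, h_1 removes one cell from a part: the last cell of
   a block is the bit before the next block start, or the last bit. *)
Fixpoint del_tail (h : bitseq -> nat) (E : bitseq) : nat :=
  if E is e :: E1 then
    (if E1 is e1 :: E2 then e1 * h (true :: E2) else h [::])
    + del_tail (fun u => h (e :: u)) E1
  else 0.

Lemma del_tailD h h' m E :
  del_tail (fun u => h u + m * h' u) E = del_tail h E + m * del_tail h' E.
Proof.
elim: E h h' => [|e E IH] h h' /=; first by rewrite muln0.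
by rewrite IH; case: E {IH} => [|e1 E]; rewrite !mulnDr ?(mulnCA m e1) addnACA.
Qed.

(** A pair 01 of D fits below E when E has a 1 at its second bit; the arbitrary bit that the pair
    replaces then sums as if E had a 1 there. *)
Lemma coefF_mulh1_tail c E : coefF (mulh1_tail c) E = del_tail (coefF c) E.
Proof.
elim: E c => [|e E IH] c //=.
rewrite !coefFD !IH mulnDr addnACA -del_tailD; congr (_ + _).
case: E {IH} => [|e1 E] /=; first by rewrite mul1n mul0n muln0 addn0.
by rewrite !(coefFZ 0) (coefFZ 1) coefFD !mul0n !muln0 !mul1n addn0.
Qed.

(** The extra leading 1 marks the first cell of the first part; with it the insertion in front
    becomes one more removal of a cell. *)
Lemma coefF_mulh1 c e E :
  coefF (mulh1 c) (e :: E) = del_tail (fun u => coefF c (behead u)) [:: true, e & E].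
Proof.
rewrite /mulh1 coefFD coefF_mulh1_tail /=.
by rewrite (coefFZ 0) (coefFZ 1) mul0n add0n mul1n.
Qed.

(* The bit 1 marks the first cell of each nonempty part. *)
Fixpoint runs (l : seq nat) : bitseq :=
  if l is m :: l1 then
    (if m is m1.+1 then true :: nseq m1 false else [::]) ++ runs l1
  else [::].

Lemma size_runs l : size (runs l) = sumn l.
Proof. by elim: l => [|[|m] l IH] //=; rewrite size_cat size_nseq IH. Qed.

Lemma runsP l : runs l = [::] \/ runs l = true :: behead (runs l).
Proof. by elim: l => [|[|m] l IH] /=; [left| |right]. Qed.

(** Inside a block the next bit is 0, so only the removal of the last cell survives; for m = 0 the
    block disappears. *)
Lemma del_tail_block h b m t : t = [::] \/ t = true :: behead t ->
  del_tail h (b :: nseq m false ++ t) =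
  h (take m (b :: nseq m false) ++ t) +
  del_tail (fun u => h (b :: nseq m false ++ u)) t.
Proof.
move=> t_head; elim: m b h => [|m IH] b h /=.
  by case: t_head => -> //=; rewrite mul1n.
by rewrite -[X in _ + X = _]/(del_tail (fun u => h (b :: u))
                                    (false :: nseq m false ++ t)) IH mul0n.
Qed.

Lemma del_tail_runs h l :
  del_tail h (runs l) =
  \sum_(i < size l)
     (0 < nth 0 l i) * h (runs (set_nth 0 l i (nth 0 l i).-1)).
Proof.
elim: l h => [|m l IH] h; first by rewrite big_ord0.
rewrite big_ord_recl; case: m => [|m].
  by rewrite mul0n; exact: IH.
rewrite -[runs (m.+1 :: l)]/(true :: nseq m false ++ runs l).
rewrite (del_tail_block _ _ _ _ (runsP l)) mul1n; congr (_ + _); last exact: IH.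
by case: m => [|m] //=; congr (h (true :: (_ ++ _))); elim: m => //= m ->.
Qed.

(* [bits a] marks the strict increases of the weakly increasing word with
   [a m] letters equal to [m], that is the proper partial sums of [a]. *)
Definition bits {N} (a : 'I_N -> nat) : bitseq := behead (runs (codom a)).

Definition decr {N} (a : 'I_N -> nat) (m : 'I_N) : 'I_N -> nat :=
  fun i => if i == m then (a i).-1 else a i.

Lemma sumn_codom N (a : 'I_N -> nat) : sumn (codom a) = \sum_i a i.
Proof. by rewrite sumnE big_map big_enum. Qed.

Lemma size_bits N (a : 'I_N -> nat) : size (bits a) = (\sum_i a i).-1.
Proof. by rewrite size_behead size_runs sumn_codom. Qed.

Lemma sum_decr N (a : 'I_N -> nat) m : 0 < a m ->
  (\sum_i decr a m i).+1 = \sum_i a i.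
Proof.
move=> am; rewrite [RHS](bigD1 m) // [X in X.+1](bigD1 m) //= /decr eqxx.
rewrite -addSn prednK //; congr (_ + _).
by apply: eq_bigr => i /negPf ->.
Qed.

(** This justifies [mulh1]: the coefficient of x^a in h_1 f collects those of x^a / x_m in f. *)
Lemma coefF_mulh1_bits c N (a : 'I_N -> nat) : 1 < \sum_i a i ->
  coefF (mulh1 c) (bits a) = \sum_m (0 < a m) * coefF c (bits (decr a m)).
Proof.
rewrite -sumn_codom -size_runs /bits.
have nthC (b : 'I_N -> nat) (i : 'I_N) : nth 0 (codom b) i = b i.
  by rewrite (nth_map i) ?size_enum_ord // nth_ord_enum.
case: (runsP (codom a)) => [->//|eqr].
case eqb: (behead (runs _)) eqr => [|e E] eqr; first by rewrite eqr.
move=> _; rewrite coefF_mulh1 -eqr del_tail_runs.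
have sza : size (codom a) = N by rewrite size_codom card_ord.
rewrite -(big_mkord xpredT (fun i => (0 < nth 0 (codom a) i) *
  coefF c (behead (runs (set_nth 0 (codom a) i (nth 0 (codom a) i).-1))))).
rewrite sza big_mkord.
apply: eq_bigr => i _; rewrite nthC; congr (_ * coefF c (behead (runs _))).
apply: (@eq_from_nth _ 0).
  by rewrite size_set_nth !size_codom !card_ord; apply/maxn_idPr.
move=> j; rewrite size_set_nth size_codom card_ord.
have /maxn_idPr -> := ltn_ord i => ltj.
rewrite nth_set_nth /= -[j]/(nat_of_ord (Ordinal ltj)) !nthC /decr.
rewrite -val_eqE /=; case: eqP => // eqji.
by congr (a _).-1; apply/val_inj.
Qed.

Definition symF k (c : bitseq -> nat) : Prop :=
  forall N (a : 'I_N -> nat) (s : {perm 'I_N}), \sum_i a i = k.+1 ->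
    coefF c (bits a) = coefF c (bits (fun i => a (s i))).

Lemma sum_perm N (a : 'I_N -> nat) (s : {perm 'I_N}) :
  \sum_i a (s i) = \sum_i a i.
Proof. by rewrite [RHS](reindex_inj (@perm_inj _ s)). Qed.

(** Lowering an exponent commutes with relabelling, so permuting the variables permutes the summands
    of [coefF_mulh1_bits]. *)
Lemma symF_mulh1 k c : symF k c -> symF k.+1 (mulh1 c).
Proof.
move=> symc N a s suma.
rewrite !coefF_mulh1_bits ?sum_perm ?suma // (reindex_inj (@perm_inj _ s)) /=.
apply: eq_bigr => m _.
case: (posnP (a (s m))) => [_|am]; [by rewrite !mul0n | congr (_ * _)].
rewrite (symc _ _ s); last by apply: eq_add_S; rewrite sum_decr.
congr (coefF c (behead (runs _))); apply: eq_map => i.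
by rewrite /decr (inj_eq perm_inj).
Qed.

Lemma symFD k c c' : symF k c -> symF k c' -> symF k (fun D => c D + c' D).
Proof. by move=> sc sc' N a s suma; rewrite !coefFD (sc _ _ s) // (sc' _ _ s). Qed.

Lemma symFZ k m c : symF k c -> symF k (fun D => m * c D).
Proof. by move=> sc N a s suma; rewrite !coefFZ (sc _ _ s). Qed.

Lemma eq_symF k c c' :
  (forall D, size D = k -> c D = c' D) -> symF k c -> symF k c'.
Proof.
move=> eqc sc N a s suma.
have eqcE (b : 'I_N -> nat) : \sum_i b i = k.+1 -> coefF c (bits b) = coefF c' (bits b).
  by move=> sumb; apply: eq_coefF => D; rewrite size_bits sumb; exact: eqc.
by rewrite -!eqcE ?sum_perm // (sc _ _ s).
Qed.

Lemma symFB k c c' : (forall D, size D = k -> c' D <= c D) ->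
  symF k c -> symF k c' -> symF k (fun D => c D - c' D).
Proof.
move=> lec sc sc' N a s suma; apply: (@addIn (coefF c' (bits a))).
rewrite {2}(sc' _ _ s) // -!coefFD.
transitivity (coefF c (bits a)).
  by apply: eq_coefF => D; rewrite size_bits suma => sD; rewrite subnK ?lec.
rewrite (sc _ _ s) //; apply: eq_coefF => D.
by rewrite size_bits sum_perm suma => sD; rewrite subnK ?lec.
Qed.

(* The coefficient of x_1 ... x_n, which is the sum of the c(D). *)
Definition total k c := coefF c (nseq k true).

Lemma totalD k c c' : total k (fun D => c D + c' D) = total k c + total k c'.
Proof. exact: coefFD. Qed.

Lemma totalZ k m c : total k (fun D => m * c D) = m * total k c.
Proof. exact: coefFZ. Qed.

Lemma del_tail_nseq h k : del_tail h (nseq k true) = k * h (nseq k.-1 true).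
Proof.
elim: k h => [|k IH] h //=; rewrite IH; case: k {IH} => [|k] /=.
  by rewrite addn0 mul1n.
by rewrite !mul1n -mulSn.
Qed.

Lemma total_mulh1 k c : total k.+1 (mulh1 c) = k.+2 * total k c.
Proof. by rewrite /total [nseq _ _]/= coefF_mulh1 (del_tail_nseq _ k.+2). Qed.

(* The Schur function of the hook (n-j,1^j). *)
Definition hook j (D : bitseq) : nat := count id D == j.

Lemma coefF_hook j E : coefF (hook j) E = 'C(count id E, j).
Proof.
elim: E j => [|e E IH] j /=; first by rewrite /hook bin0n eq_sym.
rewrite -[coefF (fun u => _) E]/(coefF (hook j) E) IH.
case: j => [|j].
  by rewrite !bin0 (eq_coefF _ (fun=> 0)) ?coefF0 ?muln0.
rewrite -[coefF (fun u => _) E]/(coefF (hook j) E) IH.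
by case: e; rewrite ?mul1n ?mul0n ?add0n ?addn0 ?binS //= addnC.
Qed.

Lemma total_hook k j : total k (hook j) = 'C(k, j).
Proof. by rewrite /total coefF_hook count_nseq mul1n. Qed.

Lemma count_runs l : count id (runs l) = count (leq 1) l.
Proof.
elim: l => [|[|m] l IH] //=.
by rewrite count_cat IH count_nseq mul0n.
Qed.

Lemma count_bits N (a : 'I_N -> nat) :
  count id (bits a) = (#|[pred i | 0 < a i]|).-1.
Proof.
have <- : count id (runs (codom a)) = #|[pred i | 0 < a i]|.
  rewrite count_runs count_map -size_filter cardE /enum_mem -filter_predI.
  by congr size; apply: eq_filter => i; rewrite /= andbT.
by rewrite /bits; case: (runsP (codom a)) => ->.
Qed.

(** The coefficient depends only on the number of nonzero exponents. *)
Lemma symF_hook k j : symF k (hook j).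
Proof.
move=> N a s suma; rewrite !coefF_hook !count_bits.
congr 'C(_.-1, j).
by rewrite -!sum1_card (reindex_inj (@perm_inj _ s)).
Qed.

(** * Hooks, two-row shapes and multiplication by h_1 *)

Fixpoint ascs (D : bitseq) : nat :=
  if D is b :: D1 then ~~ b && head false D1 + ascs D1 else 0.

(** The sentinels, a final 1 here and an initial 0 below, give every maximal run of equal bits
    exactly one pair 01. *)
Definition zero_runs D := ascs (rcons D true).
Definition one_runs D := ascs (false :: D).

(** Each pair 01 has its own 1, and a leading 1 belongs to no pair. *)
Lemma ascs_le D : head false D + ascs D <= count id D.
Proof. by elim: D => [|b D IH] //=; case: b D IH => [] [|[] D] /=; lia. Qed.

Lemma one_runs_le D : one_runs D <= count id D.
Proof. exact: ascs_le. Qed.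

Lemma zero_runs_le D : zero_runs D <= (count id D).+1.
Proof.
have := ascs_le (rcons D true); rewrite -cats1 count_cat /= /zero_runs -cats1.
lia.
Qed.

Lemma one_runs_gt0 D : 0 < count id D -> 0 < one_runs D.
Proof.
rewrite /one_runs /=; elim: D => [|b D IH] //=.
by case: b D IH => [] [|[] D] //=; lia.
Qed.

Lemma zero_runs_gt0 D : count id D < size D -> 0 < zero_runs D.
Proof.
rewrite /zero_runs; elim: D => [|b D IH] //=.
by case: b D IH => [] [|[] D] //=; have := count_size id D; lia.
Qed.

(** Collapsing a pair 01 to 1 keeps the number of 1s, collapsing it to 0 lowers it by one. Deleting
    a final 0 keeps it; this is the pair made by the sentinel. *)
Lemma mulh1_tail_count (f : nat -> nat) D :
  mulh1_tail (fun u => f (count id u)) D =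
  f (count id D) * ascs (rcons D true) + f (count id D).-1 * ascs D.
Proof.
elim: D f => [|b D IH] f; first by rewrite /= !muln0.
rewrite [LHS]/= (IH (fun m => f (b + m))).
have := ascs_le D.
case: b D {IH} => [] [|[] D] /= ascsD; rewrite ?add0n ?add1n /=; try lia.
case: (posnP (count id D)) => [cD0|/prednK -> //].
by have -> : head false D + ascs D = 0 by [lia]; rewrite !muln0.
Qed.

(* Multiplying a hook Schur function by h_1 adds a corner at the end of the
   arm, at the end of the leg, or inside: the last contribution is counted by
   the runs beyond the first one. *)
Lemma mulh1_count (f : nat -> nat) D :
  mulh1 (fun u => f (count id u)) D =
  f (count id D) * zero_runs D + f (count id D).-1 * one_runs D.
Proof.
rewrite /mulh1 mulh1_tail_count /zero_runs /one_runs.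
by case: D => [|[] D] //=; rewrite ?add0n ?add1n /=; nia.
Qed.

(* The Schur function of the partition (n-2,2), by the Pieri rule. *)
Definition two_row D := mulh1 (hook 1) D - hook 1 D - hook 2 D.

(** The coefficient counts the runs of 0s if D has one element and the runs of 1s if it has two,
    hence is 1 or 2 there, and it is 0 elsewhere. So the subtractions in [two_row] and
    [two_row_defect] are exact. *)
Lemma mulh1_hook1 k D : 0 < k -> size D = k.+1 ->
  mulh1 (hook 1) D = hook 1 D + hook 2 D + two_row D /\
  mulh1 (hook 1) D <= 2 * (hook 1 D + hook 2 D).
Proof.
move=> k0 sD.
have := zero_runs_le D; have := one_runs_le D.
have := zero_runs_gt0 D; have := one_runs_gt0 D.
rewrite /two_row (mulh1_count (fun m => m == 1)).
rewrite /hook sD; case: (count id D) => [|[|[|m]]] /=; lia.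
Qed.

(* X = s_(n-1,1) + s_(n-2,1,1) - s_(n-2,2) *)
Definition two_row_defect D := hook 1 D + hook 2 D - two_row D.

Lemma two_row_defectK k D : 0 < k -> size D = k.+1 ->
  two_row_defect D + two_row D = hook 1 D + hook 2 D.
Proof.
by move=> k0 sD; have := mulh1_hook1 _ _ k0 sD; rewrite /two_row_defect; lia.
Qed.

Lemma symF_two_row k : symF k.+1 two_row.
Proof.
case: k => [|k].
  (* For n = 2 the truncated differences vanish on both descent sets. *)
  apply: (@eq_symF _ (fun=> 0)); last by move=> N a s _; rewrite !coefF0.
  by case=> [|[] [|b D]].
apply: symFB; last exact: symF_hook.
  by move=> D sD; have := mulh1_hook1 _ _ (ltn0Sn k) sD; lia.
apply: symFB; [|exact/symF_mulh1/symF_hook | exact: symF_hook].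
by move=> D sD; have := mulh1_hook1 _ _ (ltn0Sn k) sD; lia.
Qed.

Lemma symF_two_row_defect k : 0 < k -> symF k.+1 two_row_defect.
Proof.
move=> k0; apply: symFB; last exact: symF_two_row.
  by move=> D sD; have := two_row_defectK _ _ k0 sD; lia.
by apply: symFD; apply: symF_hook.
Qed.

Lemma bin2K k : 2 * 'C(k, 2) = k * k.-1.
Proof. by elim: k => [|[|k] IH] //; rewrite binS bin1 mulnDr IH /=; nia. Qed.

(** With n = k.+2 this is n(n-3)/2, one less than the size of the hook (n-2,1,1). *)
Lemma total_two_row k : 0 < k -> total k.+1 two_row = ('C(k.+1, 2)).-1.
Proof.
move=> k0.
have : total k.+1 (mulh1 (hook 1)) =
       total k.+1 (fun D => hook 1 D + hook 2 D + two_row D).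
  apply: eq_coefF => D; rewrite size_nseq => sD.
  by have := mulh1_hook1 _ _ k0 sD; lia.
rewrite total_mulh1 !totalD !total_hook !bin1.
by have := bin2K k.+1; lia.
Qed.

Lemma total_two_row_defect k : 0 < k -> total k.+1 two_row_defect = k.+2.
Proof.
move=> k0.
have : total k.+1 (fun D => two_row_defect D + two_row D) =
       total k.+1 (fun D => hook 1 D + hook 2 D).
  apply: eq_coefF => D; rewrite size_nseq => sD.
  exact: two_row_defectK sD.
rewrite !totalD !total_hook bin1 total_two_row //.
by have := bin2K k.+1; nia.
Qed.

(* h_1^n: its coefficients count the permutations of n = k.+1 letters by
   descent set. *)
Definition beta k : bitseq -> nat := iter k mulh1 (fun=> 1).

(** Pascal's rule uses one run of 0s and one of 1s. When D has one or two elements, each further run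
    has weight C(k,1) = k; these runs form the k copies of [two_row]. *)
Lemma mulh1_bin k D : size D = k.+1 ->
  'C(k.+1, count id D) + k * two_row D <=
  mulh1 (fun u => 'C(k, count id u)) D.
Proof.
move=> sD; rewrite (mulh1_count (fun m => 'C(k, m))).
have cD := count_size id D.
have := zero_runs_gt0 D; have := one_runs_gt0 D.
rewrite /two_row (mulh1_count (fun m => m == 1)).
rewrite /hook; move: cD; rewrite sD.
case: (count id D) => [|[|[|m]]] /= cD; rewrite ?bin0 ?bin1 ?binS ?mul0n.
- by rewrite add0n !subn0 muln0; lia.
- by case: k cD sD => [|k] cD sD ones zeros; nia.
- case: k cD sD => [|k] // cD sD ones zeros.
  have z0 : 'C(k.+1, 2) <= 'C(k.+1, 2) * zero_runs D.
    case: k {sD cD} zeros => [|k] zeros; first by rewrite bin_small.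
    by rewrite leq_pmulr // zeros.
  by rewrite bin1; nia.
- move=> /(_ isT) ones zeros; rewrite !subn0 muln0 addn0.
  apply: leq_add; last by rewrite leq_pmulr.
  move: cD; rewrite leq_eqVlt => /predU1P[[<-]|ltm]; first by rewrite bin_small.
  by rewrite leq_pmulr // zeros.
Qed.

(** With n = k.+1, h_1^n contains the hook (n-j,1^j) once for each of its C(k,j) standard
    tableaux. *)
Lemma beta_ge_bin k D : size D = k -> 'C(k, count id D) <= beta k D.
Proof.
elim: k D => [|k IH] D sD; first by rewrite (size0nil sD).
apply: leq_trans (mulh1_le _ _ _ _ sD IH).
by apply: leq_trans (mulh1_bin _ _ sD); exact: leq_addr.
Qed.

Lemma beta_ge k D : size D = k.+1 ->
  'C(k.+1, count id D) + k * two_row D <= beta k.+1 D.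
Proof.
move=> sD; apply: leq_trans (mulh1_bin _ _ sD) _.
exact: mulh1_le sD (beta_ge_bin k).
Qed.

(* h_n + e_n + (n-1) s_(n-1,1), with n = k.+1 *)
Definition reserve k D := (hook 0 D + hook k D + k * hook 1 D).

(* h_n h_1 = h_(n+1) + s_(n,1),  e_n h_1 = e_(n+1) + s_(2,1^(n-1)) and
   s_(n-1,1) h_1 = s_(n,1) + s_(n-1,2) + s_(n-1,1,1) *)
Lemma mulh1_reserve k D : 2 < k -> size D = k.+1 ->
  reserve k.+1 D + k * (hook 2 D + two_row D) + hook k D <=
  mulh1 (reserve k) D.
Proof.
move=> k2 sD.
rewrite {2}/reserve /hook (mulh1_count (fun m => (m == 0) + (m == k) + k * (m == 1))).
have cD := count_size id D.
have := zero_runs_gt0 D; have := one_runs_gt0 D.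
rewrite /two_row (mulh1_count (fun m => m == 1)) /reserve /hook.
move: cD; rewrite sD.
case: k k2 {sD} => [|[|[|k]]] // _.
case: (count id D) => [|[|[|m]]] /= cD ones zeros; first by lia.
- by have := zeros isT; nia.
- by have := ones isT; nia.
rewrite !mul0n !muln0 !addn0 !add0n addnC; apply: leq_add.
  by case: eqP => // eqm; rewrite mul1n zeros // eqm.
by rewrite leq_pmulr // ones.
Qed.

(** * Permutations realize vectors *)

Definition desbits (s : seq nat) : bitseq :=
  if s is x :: s1 then pairmap (fun x y => y < x) x s1 else [::].

(** Transpose of [mulh1_tail]: the results of the insertions into D, in order of position. *)
Fixpoint inserts_tail (D : bitseq) : seq bitseq :=
  if D is b :: D1 then [:: false, true & D1] :: map (cons b) (inserts_tail D1)
  else [:: [:: false]].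

Definition inserts D := (true :: D) :: inserts_tail D.

Lemma mulh1_tail_pred1 D0 D :
  mulh1_tail (fun u => D0 == u) D = count_mem D (inserts_tail D0).
Proof.
elim: D0 D => [|x D0 IH] [|b D] /=.
- by [].
- by rewrite (mulh1_tail0 D); case: D => [|b1 D]; case: b; rewrite ?muln0.
- by elim: (inserts_tail D0).
rewrite count_map.
have -> : mulh1_tail (fun u => x :: D0 == b :: u) D =
          (x == b) * mulh1_tail (fun u => D0 == u) D.
  case: (eqVneq x b) => [->|neq].
    by rewrite mul1n; apply: eq_mulh1_tail => u; rewrite eqseq_cons eqxx.
  rewrite mul0n -(mulh1_tail0 D); apply: eq_mulh1_tail => u.
  by rewrite eqseq_cons (negPf neq).
rewrite IH; congr (_ + _).
  case: D => [|b1 D]; first by rewrite muln0; case: b.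
  by case: b b1 x => [] [] []; rewrite /= ?mul0n ?mul1n ?addn0.
case: (eqVneq x b) => [->|neq].
  by rewrite mul1n; apply: eq_count => u; rewrite /= eqseq_cons eqxx.
rewrite mul0n -(count_pred0 (inserts_tail D0)); apply: eq_count => u.
by rewrite /= eqseq_cons (negPf neq).
Qed.

Lemma mulh1_pred1 D0 D : mulh1 (fun u => D0 == u) D = count_mem D (inserts D0).
Proof.
rewrite /mulh1 mulh1_tail_pred1 /=; congr (_ + _).
by case: D => [|[] D]; rewrite //= mul1n.
Qed.

Definition insert_at (m : nat) s j := take j s ++ m :: drop j s.

Lemma map_iotaS (T : Type) (f : nat -> T) n :
  [seq f j | j <- iota 0 n.+1] = f 0 :: [seq f j.+1 | j <- iota 0 n].
Proof. by rewrite -[iota 0 n.+1]/(0 :: iota (1 + 0) n) iotaDl /= -map_comp. Qed.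

(** Between two letters a larger letter makes an ascent and then a descent, whatever their order; at
    the end it makes an ascent. *)
Lemma inserts_desbits_tail m x s : all (ltn^~ m) (x :: s) ->
  [seq pairmap (fun x y => y < x) x (insert_at m s j) | j <- iota 0 (size s).+1]
    = inserts_tail (pairmap (fun x y => y < x) x s).
Proof.
elim: s x => [|y s IH] x /andP[ltx lts].
  by rewrite /= ltnNge ltnW.
have lty : y < m by case/andP: lts.
rewrite map_iotaS [RHS]/= -IH // -map_comp /=.
by rewrite ltnNge (ltnW ltx) lty.
Qed.

Lemma inserts_desbits m s : s != [::] -> all (ltn^~ m) s ->
  [seq desbits (insert_at m s j) | j <- iota 0 (size s).+1] =
  inserts (desbits s).
Proof.
case: s => [|x s] // _ lts.
rewrite map_iotaS /inserts [desbits (x :: s)]/= -(inserts_desbits_tail m) //=.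
by have -> : x < m by case/andP: lts.
Qed.

Definition word {n} (w : {perm 'I_n}) : seq nat := [seq val (w i) | i <- enum 'I_n].

Lemma size_word n (w : {perm 'I_n}) : size (word w) = n.
Proof. by rewrite size_map size_enum_ord. Qed.

Lemma nth_word n (w : {perm 'I_n}) (i : 'I_n) : nth 0 (word w) i = w i.
Proof. by rewrite (nth_map i) ?size_enum_ord // nth_ord_enum. Qed.

Lemma word_lift_perm n (j : 'I_n.+1) (w : {perm 'I_n}) :
  word (lift_perm j ord_max w) = insert_at n (word w) j.
Proof.
have szt : size (take j (word w)) = j.
  by rewrite size_takel // size_word -ltnS ltn_ord.
apply: (@eq_from_nth _ 0).
  rewrite size_cat szt /= size_drop !size_word.
  by have := ltn_ord j; lia.
move=> i; rewrite size_word => lti.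
rewrite -[i]/(val (Ordinal lti)); move: (Ordinal lti) => {lti} {}i.
rewrite nth_word nth_cat szt.
case: (unliftP j i) => [i'|] ->; last by rewrite lift_perm_id ltnn subnn.
rewrite lift_perm_lift lift_max -nth_word /= /bump.
case: (leqP j i') => [leji|ltij].
  by rewrite add1n ltnNge (leqW leji) subSn //= nth_drop subnKC.
by rewrite add0n ltij nth_take.
Qed.

Lemma lift_perm_inj n :
  injective (fun p : {perm 'I_n} * 'I_n.+1 => lift_perm p.2 ord_max p.1).
Proof.
move=> [w j] [w' j'] /= eqw.
have eqj : j = j'.
  by apply: (@perm_inj _ (lift_perm j ord_max w)); rewrite {2}eqw !lift_perm_id.
rewrite -eqj in eqw *; congr (_, _); apply/permP => i.
by apply: (@lift_inj _ ord_max); rewrite -!(lift_perm_lift j) eqw.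
Qed.

Definition descs {n} (w : {perm 'I_n}) : bitseq := desbits (word w).

Lemma size_descs n (w : {perm 'I_n}) : size (descs w) = n.-1.
Proof.
rewrite /descs /desbits -{2}(size_word _ w).
by case: (word w) => //= x s; rewrite size_pairmap.
Qed.

Lemma leq_sum_inj (I J : finType) (f : I -> J) (F : J -> nat) :
  injective f -> \sum_i F (f i) <= \sum_j F j.
Proof.
move=> f_inj; rewrite [leqRHS](bigID [in f @: setT]) /=.
rewrite (big_imset _ (in2W f_inj)) /= [X in _ <= X + _](eq_bigl xpredT) ?leq_addr // => i.
by rewrite inE.
Qed.

(** Inserting the largest letter at all positions of all permutations yields distinct permutations,
    with descent sets given by [inserts]. *)
Lemma beta_le k D : size D = k -> beta k D <= #|[set w : {perm 'I_k.+1} | descs w == D]|.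
Proof.
have cardE n u : #|[set w : {perm 'I_n} | descs w == u]| =
                 \sum_(w : {perm 'I_n}) (descs w == u).
  by rewrite -sum1dep_card big_mkcond.
elim: k D => [|k IH] D sD.
  rewrite (size0nil sD) cardE (bigD1 1%g) //=.
  by rewrite (size0nil (size_descs 1 1%g)).
apply: leq_trans (mulh1_le _ _ _ _ sD IH) _.
rewrite (eq_mulh1 _ _ _ (cardE _)) mulh1_sum cardE.
rewrite (eq_bigr (fun w => \sum_(j < k.+2) (descs (lift_perm j ord_max w) == D))).
  rewrite pair_bigA.
  exact: (leq_sum_inj _ _ _ (fun w => descs w == D) (lift_perm_inj k.+1)).
move=> w _; rewrite mulh1_pred1 -(inserts_desbits k.+1).
- rewrite size_word count_map -val_enum_ord count_map -sum1_count big_mkcond.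
  rewrite big_enum; apply: eq_bigr => j _.
  by rewrite /= /descs word_lift_perm; case: eqP.
- by rewrite -size_eq0 size_word.
by apply/allP => _ /mapP[i _ ->] /=.
Qed.

(** * ** Monomial coefficients of Gessel's functions *)

Definition lt_ord {N} := [rel x y : 'I_N | x < y].
Definition le_ord {N} := [rel x y : 'I_N | x <= y].

Definition sorted_word {N} (a : 'I_N -> nat) : seq 'I_N :=
  flatten [seq nseq (a m) m | m <- enum 'I_N].

Lemma size_sorted_word N (a : 'I_N -> nat) : size (sorted_word a) = \sum_m a m.
Proof.
rewrite size_flatten /shape -map_comp sumnE big_map big_enum.
by apply: eq_bigr => m _; rewrite /= size_nseq.
Qed.

Lemma count_sorted_word N (a : 'I_N -> nat) m : count_mem m (sorted_word a) = a m.
Proof.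
rewrite count_flatten -map_comp sumnE big_map big_enum (bigD1 m) //=.
rewrite count_nseq /= eqxx mul1n big1 ?addn0 // => i neq_im.
by rewrite count_nseq /= (negPf neq_im).
Qed.

Lemma lt_ord_trans N : transitive (@lt_ord N).
Proof. by move=> y x z; apply: ltn_trans. Qed.

Lemma le_ord_trans N : transitive (@le_ord N).
Proof. by move=> y x z; apply: leq_trans. Qed.

Lemma sorted_enum_ord N : sorted (@lt_ord N) (enum 'I_N).
Proof. by have := iota_ltn_sorted 0 N; rewrite -val_enum_ord sorted_map. Qed.

Lemma pairmap_block N (m : 'I_N) t s :
  pairmap lt_ord m (nseq t m ++ s) = nseq t false ++ pairmap lt_ord m s.
Proof. by elim: t => //= t ->; rewrite ltnn. Qed.

Lemma pairmap_sorted_word N (a : 'I_N -> nat) r x : path lt_ord x r ->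
  pairmap lt_ord x (flatten [seq nseq (a m) m | m <- r]) = runs [seq a m | m <- r].
Proof.
elim: r x => [|m r IH] x //= /andP[ltxm pr].
case: (a m) => [|t] /=.
  by apply: IH; apply: (path_le (@lt_ord_trans N)) ltxm pr.
by rewrite ltxm pairmap_block // IH.
Qed.

Definition incbits {N} (s : seq 'I_N) : bitseq :=
  if s is x :: s1 then pairmap lt_ord x s1 else [::].

(** Steps inside a block of equal letters are not strict, steps between blocks are. The first block
    has no step before it, whence the [behead] in [bits]. *)
Lemma incbits_sorted_word N (a : 'I_N -> nat) : incbits (sorted_word a) = bits a.
Proof.
have := sorted_enum_ord N.
rewrite /sorted_word /bits /codom /image_mem.
elim: (enum 'I_N) => [|m r IH] //= pr; case: (a m) => [|t] /=.
  exact/IH/path_sorted/pr.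
by rewrite pairmap_block // pairmap_sorted_word.
Qed.

Lemma sorted_sorted_word N (a : 'I_N -> nat) : sorted le_ord (sorted_word a).
Proof.
have := sorted_enum_ord N.
rewrite /sorted_word (sorted_pairwise (@lt_ord_trans N)) (sorted_pairwise (@le_ord_trans N)).
elim: (enum 'I_N) => [|m r IH] //= /andP[ltr pr].
rewrite pairwise_cat IH // andbT; apply/andP; split; last first.
  by elim: (a m) => //= t ->; rewrite all_nseq /= leqnn orbT.
apply/allrelP => x y /nseqP[-> _] /flattenP[_ /mapP[z zr ->]] /nseqP[-> _].
by apply: ltnW; apply: (allP ltr).
Qed.

Lemma sorted_word_uniq N (a : 'I_N -> nat) s :
  sorted le_ord s -> (forall m, count_mem m s = a m) -> s = (sorted_word a).
Proof.
move=> ss cs; apply: (@sorted_eq _ le_ord) => //.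
- exact: le_ord_trans.
- by move=> x y le2; apply/val_inj/anti_leq.
- exact: sorted_sorted_word.
by apply/allP => m _; rewrite /= cs count_sorted_word.
Qed.

Lemma all2_nthP (s t : bitseq) : size s = size t ->
  reflect (forall i, i < size s -> nth false s i -> nth false t i)
          (all2 implb s t).
Proof.
move=> eqst; rewrite all2E eqst eqxx /=.
apply: (iffP (all_nthP (false, false))) => st i; have := st i;
  by rewrite size_zip eqst minnn nth_zip //= => sti /sti/implyP.
Qed.

Lemma nth_desbits s i : i.+1 < size s ->
  nth false (desbits s) i = (nth 0 s i.+1 < nth 0 s i).
Proof. by case: s => //= x s lti; rewrite (nth_pairmap 0). Qed.

Lemma nth_incbits N (x0 : 'I_N) s i : i.+1 < size s ->
  nth false (incbits s) i = (nth x0 s i < nth x0 s i.+1).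
Proof. by case: s => //= x s lti; rewrite (nth_pairmap x0). Qed.

Lemma DesE n (w : {perm 'I_n}) i : i.+1 < n ->
  Des w i = nth false (descs w) i.
Proof.
move=> lti; rewrite nth_desbits ?size_word //.
pose k := Ordinal lti; pose j := Ordinal (ltnW lti).
rewrite -[i.+1]/(val k) -[i in RHS]/(val j) !nth_word.
apply/existsP/idP => [[j' /existsP[k' /and3P[/eqP ej /eqP ek]]]|lt_w].
  by have -> : j' = j by [exact: val_inj]; have -> : k' = k by [exact: val_inj].
by exists j; apply/existsP; exists k; rewrite /= !eqxx.
Qed.

(** Only [sorted_word a] is weakly increasing with content a; it is counted when the descents of w
    are among its strict increases. *)
Lemma FcoefE k (w : {perm 'I_k.+1}) N (a : 'I_N -> nat) :
  Fcoef k.+1 (Des w) a =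
  (\sum_m a m == k.+1) && all2 implb (descs w) (bits a).
Proof.
rewrite /Fcoef; set A := [set f | _].
pose word_of (f : {ffun 'I_k.+1 -> 'I_N}) := [seq f i | i <- enum 'I_k.+1].
have size_wf f : size (word_of f) = k.+1 by rewrite size_map size_enum_ord.
have nth_wf x0 f (i : 'I_k.+1) : nth x0 (word_of f) i = f i.
  by rewrite (nth_map i) ?size_enum_ord // nth_ord_enum.
have count_wf f m : count_mem m (word_of f) = #|[set j | f j == m]|.
  by rewrite count_map -size_filter cardsE cardE /enum_mem -filter_predI;
     congr size; apply: eq_filter => i; rewrite /= andbT.
have inA f : (f \in A) =
    (word_of f == sorted_word a) && all2 implb (descs w) (bits a).
  have stepE (j j' : 'I_k.+1) (jj' : val j' == j.+1) :
      [/\ nth false (incbits (word_of f)) j = (f j < f j')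
        & Des w j = nth false (descs w) j].
    have ltj : j.+1 < k.+1 by rewrite -(eqP jj') ltn_ord.
    rewrite (nth_incbits _ (f j)) ?size_wf // -(eqP jj') !nth_wf.
    by rewrite DesE.
  have size_bits_f : size (descs w) = size (incbits (word_of f)).
    rewrite size_descs; have := size_wf f.
    by case: (word_of f) => //= x s [<-]; rewrite size_pairmap.
  rewrite inE; apply/andP/andP => [[/forallP stepA /forallP cntA]|].
    have eqw : word_of f = sorted_word a.
      apply: sorted_word_uniq => [|m]; last by rewrite count_wf (eqP (cntA m)).
      case eqs: (word_of f) => [|x0 s] //; rewrite -eqs.
      apply/(sortedP x0) => i; rewrite size_wf => lti.
      have := forallP (stepA (Ordinal (ltnW lti))) (Ordinal lti).
      rewrite eqxx /= => /andP[le_f _].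
      rewrite -[i.+1]/(val (Ordinal lti)) -[i in nth _ _ i]/(val (Ordinal (ltnW lti))).
      by rewrite !nth_wf.
    split; first exact/eqP.
    rewrite -incbits_sorted_word -eqw; apply/all2_nthP => // i.
    rewrite size_descs /= => lti.
    pose j := Ordinal (ltnW lti : i < k.+1); pose j' := Ordinal (lti : i.+1 < k.+1).
    have [eqf eqD] := stepE j j' (eqxx _).
    rewrite -[i]/(val j) -eqD eqf => Dj.
    have /andP[_] := implyP (forallP (stepA j) j') (eqxx _).
    by rewrite Dj.
  move=> [/eqP eqw]; rewrite -incbits_sorted_word -eqw => /all2_nthP allw.
  have {}allw := allw size_bits_f; split; last first.
    by apply/forallP => m; rewrite -count_wf eqw count_sorted_word.
  apply/forallP => j; apply/forallP => j'; apply/implyP => jj'.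
  have [eqf eqD] := stepE j j' jj'.
  have ltj : j.+1 < k.+1 by rewrite -(eqP jj') ltn_ord.
  apply/andP; split; last first.
    by apply/implyP; rewrite eqD -eqf; apply: allw; rewrite size_descs.
  have := sorted_sorted_word _ a; rewrite -eqw => /(sortedP (f j)) /(_ j).
  by rewrite size_wf ltj -(eqP jj') !nth_wf => /(_ isT).
case: eqP => [suma|sum_neq] /=; last first.
  rewrite (_ : A = set0) ?cards0 //; apply/setP => f; rewrite inA inE.
  by case: eqP => // eqw; case: sum_neq; rewrite -size_sorted_word -eqw.
have szt : size (sorted_word a) == k.+1 by rewrite size_sorted_word suma.
pose f0 := [ffun i => tnth (Tuple szt) i].
have wf0 : word_of f0 = sorted_word a.
  rewrite /word_of (eq_map (ffunE _)); exact: (map_tnth_enum (Tuple szt)).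
case: (all2 _ _ _) inA => inA; last first.
  by rewrite (_ : A = set0) ?cards0 //; apply/setP => f; rewrite inA inE andbF.
rewrite (_ : A = [set f0]) ?cards1 //; apply/setP => f; rewrite inA inE andbT -wf0.
apply/eqP/eqP => [eqf|->//]; apply/ffunP => i.
by rewrite -(nth_wf (f i)) eqf nth_wf.
Qed.

Lemma card_index_lt (T : finType) (A : {set T}) m : m <= #|A| ->
  #|[set x in A | index x (enum A) < m]| = m.
Proof.
move=> lem; have -> : [set x in A | index x (enum A) < m] = [set x in take m (enum A)].
  apply/setP => x; rewrite !inE; case: (boolP (x \in A)) => xA /=.
    by rewrite in_take // mem_enum.
  by apply/esym/negbTE; apply: contra xA => /mem_take; rewrite mem_enum.
rewrite cardsE (card_uniqP _) ?take_uniq ?enum_uniq //.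
by rewrite size_takel // -cardE.
Qed.

Lemma descs1 k : descs (1%g : {perm 'I_k.+1}) = nseq k false.
Proof.
apply: (@eq_from_nth _ false); rewrite size_descs ?size_nseq // => i lti.
rewrite nth_desbits ?size_word // nth_nseq lti.
rewrite -[i.+1]/(val (Ordinal (lti : i.+1 < k.+1))).
rewrite -[i in _ < nth _ _ i]/(val (Ordinal (ltnW lti : i < k.+1))) !nth_word !perm1 /=.
by rewrite ltnNge leqnSn.
Qed.

Lemma descs_delta k : descs (delta k.+1) = nseq k true.
Proof.
apply: (@eq_from_nth _ false); rewrite size_descs ?size_nseq // => i lti.
rewrite nth_desbits ?size_word // nth_nseq lti.
rewrite -[i.+1]/(val (Ordinal (lti : i.+1 < k.+1))).
rewrite -[i in _ < nth _ _ i]/(val (Ordinal (ltnW lti : i < k.+1))) !nth_word !permE /=.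
by move: lti => /=; lia.
Qed.

Lemma realize k c : symF k c ->
    (forall D, size D = k -> c D <= beta k D) ->
    c (nseq k false) = 0 -> c (nseq k true) = 0 ->
  exists S : {set {perm 'I_k.+1}},
    [/\ symmetric_set S, #|S| = total k c, 1%g \notin S & delta k.+1 \notin S].
Proof.
move=> symc lec c0 cT.
pose cls D := [set w : {perm 'I_k.+1} | descs w == D].
(* From each descent class S takes the first c(D) permutations in its enumeration. *)
pose S := [set w : {perm 'I_k.+1} | index w (enum (cls (descs w))) < c (descs w)].
have cS D : size D = k -> c D = \sum_(w in S) (descs w == D).
  move=> sD; rewrite -[LHS](card_index_lt _ (cls D)); last first.
    by apply: leq_trans (lec _ sD) _; apply: beta_le.
  rewrite -sum1_card -big_mkcondr; apply: eq_bigl => w; rewrite !inE andbC.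
  by case: eqP => [->|]; rewrite ?andbF ?andbT.
have coefS E : size E = k -> coefF c E = \sum_(w in S) all2 implb (descs w) E.
  move=> sE; rewrite (@eq_coefF _ (fun D => \sum_(w in S) (descs w == D))).
    by rewrite coefF_sum; apply: eq_bigr => w _; rewrite coefF_pred1 ?size_descs.
  by move=> D sD; apply: cS; rewrite sD.
exists S; split.
- move=> N a s; rewrite /Qcoef.
  under eq_bigr do rewrite FcoefE.
  under [RHS]eq_bigr do rewrite FcoefE sum_perm.
  case: eqP => [suma|_] /=; last by rewrite !big1.
  have sza (b : 'I_N -> nat) : \sum_m b m = k.+1 -> size (bits b) = k.
    by move=> sumb; rewrite size_bits sumb.
  by rewrite -!coefS ?sza ?sum_perm // (symc _ _ s).
- rewrite /total coefS ?size_nseq // -sum1_card; apply: eq_bigr => w _.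
  have -> // : all2 implb (descs w) (nseq k true).
  by have := size_descs _ w; move: (descs w) => D /= <-; elim: D => //= b D ->; rewrite implybT.
- by rewrite inE descs1 c0.
by rewrite inE descs_delta cT.
Qed.

(** * Attainable sizes *)

(* Here n = k.+1, and hook 0, hook k are the classes of the two monotone
   permutations. *)
Definition admissible k p : Prop :=
  exists c, [/\ symF k c, total k c = p &
    forall D, size D = k -> c D + (hook 0 D + hook k D) <= beta k D].

Definition reserved k p : Prop :=
  exists c, [/\ symF k c, total k c = p &
    forall D, size D = k -> c D + reserve k D <= beta k D].

Lemma reserved_admissible k p : reserved k p -> admissible k p.
Proof.
move=> [c [symc tot lec]]; exists c; split=> // D sD.
by apply: leq_trans (lec D sD); rewrite leq_add2l leq_addr.
Qed.

(** A constant sequence has no pair 01, so only the insertion at one end contributes. *)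
Lemma beta_nseq b k : beta k (nseq k b) = 1.
Proof.
elim: k => [|k IH] //=; rewrite -[RHS]IH -/(beta k).
rewrite -[b :: nseq k b]/(nseq k.+1 b) /mulh1 [nseq _ _]/=.
case: b {IH}; rewrite ?mul1n ?mul0n.
  suff -> : forall c, mulh1_tail c (true :: nseq k true) = 0 by rewrite addn0.
  elim: k => [|k IH] c //.
  have := IH (fun u => c (true :: u)).
  by rewrite [mulh1_tail c _]/= mul0n.
move: (beta k) => c; rewrite add0n.
elim: k c => [|k IH] c; first by rewrite /= mul1n addn0.
have := IH (fun u => c (false :: u)).
  by rewrite [mulh1_tail c _]/= mul0n.
Qed.

Lemma admissible_set k p : 0 < k -> admissible k p ->
  exists S : {set {perm 'I_k.+1}},
    [/\ symmetric_set S, #|S| = p, 1%g \notin S & delta k.+1 \notin S].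
Proof.
move=> k0 [c [symc <- lec]]; apply: realize => //.
- by move=> D sD; apply: leq_trans (lec D sD); apply: leq_addr.
- have := lec _ (size_nseq k false).
  by rewrite beta_nseq /hook count_nseq mul0n eqxx; lia.
have := lec _ (size_nseq k true).
by rewrite beta_nseq /hook count_nseq mul1n eqxx; lia.
Qed.

(** Here n = k.+2. Each of the j exchanges of s_(n-2,1,1) for s_(n-2,2) lowers the size by 1, and
    s_(2,1^(n-2)), of size n - 1, lowers it by 1 modulo n; so j + e reaches all residues. *)
Lemma reserved_mulh1 k p j e : 2 < k -> reserved k p -> j <= k -> e <= 1 ->
  reserved k.+1 (k.+2 * p + ((k - j) * 'C(k.+1, 2) + j * ('C(k.+1, 2)).-1 + e * k.+1)).
Proof.
move=> k2 [c [symc <- lec]] lej lee.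
exists (fun D => mulh1 c D +
          ((k - j) * hook 2 D + j * two_row D + e * hook k D)); split.
- apply: symFD; first exact: symF_mulh1.
  apply: symFD; last exact/symFZ/symF_hook.
  by apply: symFD; apply: symFZ; [apply: symF_hook | apply: symF_two_row].
- rewrite totalD total_mulh1 !totalD !totalZ !total_hook total_two_row ?(ltn_trans _ k2) //.
  by rewrite binSn.
move=> D sD.
have : mulh1 (fun u => c u + reserve k u) D <= beta k.+1 D by exact: mulh1_le sD lec.
have := mulh1_reserve _ _ k2 sD; rewrite mulh1D.
move: (mulh1 c D) (mulh1 _ D) (reserve _ D) (hook 2 D) (two_row D) (hook k D).
move: (beta _ D) => B m m' R h t hk le1 le2.
have : (k - j) * h <= k * h by rewrite leq_mul2r leq_subr orbT.
have : j * t <= k * t by rewrite leq_mul2r lej orbT.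
have : e * hk <= hk by rewrite -[leqRHS]mul1n leq_mul2r lee orbT.
lia.
Qed.

Lemma bin_pred2 k : 'C(k.+2, k) = 'C(k.+2, 2).
Proof. by rewrite -(@bin_sub k.+2 2) // -addn2 addnK. Qed.

Lemma reserved_seed k j a b q :
    2 < k -> j <= k -> a <= 'C(k.+1, 2) -> b <= 'C(k.+1, 2) -> q <= k.+1 ->
    (3 < k) || (b == 0) ->
  reserved k.+1 (j * ('C(k.+1, 2)).-1 + a * 'C(k.+1, 2) + b * 'C(k.+1, 2) + q * k.+1).
Proof.
move=> k2 lej lea leb leq k3.
exists (fun D => j * two_row D + a * hook 2 D + b * hook k.-1 D + q * hook k D).
split.
- by do !apply: symFD; apply: symFZ; first [exact: symF_two_row | exact: symF_hook].
- rewrite !totalD !totalZ !total_hook total_two_row ?(ltn_trans _ k2) //.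
  rewrite binSn; case: k k2 {lej lea leb leq k3} => // k _.
  by rewrite bin_pred2.
move=> D sD; apply: leq_trans (beta_ge _ _ sD).
rewrite /reserve /hook.
have : j * two_row D <= k * two_row D by rewrite leq_mul2r lej orbT.
move: (count_size id D) (two_row D); rewrite sD => cD t.
have binq : 'C(k.+1, k) = k.+1 by rewrite binSn.
have binb : 'C(k.+1, k.-1) = 'C(k.+1, 2).
  by case: k k2 {lej lea leb leq k3 sD cD binq} => // k _; rewrite bin_pred2.
have := bin1 k.+1; have := bin0 k.+1; have := binn k.+1.
move: (count id D) cD => m cD.
(* A hook lives on one value of the number of descents, so the bound is checked value by value. *)
have [->|m0] := eqVneq m 0; first by lia.
have [->|m1] := eqVneq m 1; first by lia.
have [->|mK] := eqVneq m k.+1; first by lia.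
have [->|mk] := eqVneq m k; first by rewrite binq; lia.
have [->|m2] := eqVneq m 2; first by lia.
have [->|mk1] := eqVneq m k.-1; first by rewrite binb; lia.
lia.
Qed.

(** X is at most s_(n-1,1) + s_(n-2,1,1), so its i copies share the k.+1 copies of s_(n-1,1) with
    q1. *)
Lemma admissible_seed k i q1 q2 b :
    3 < k -> i <= k -> i + q1 <= k.+1 -> q2 <= k.+1 -> b <= 'C(k.+1, 2) ->
  admissible k.+1 (i * k.+2 + (q1 + q2) * k.+1 + b * 'C(k.+1, 2)).
Proof.
move=> k3 lei leq1 leq2 leb; have k0 : 0 < k by lia.
exists (fun D => i * two_row_defect D + q1 * hook 1 D + q2 * hook k D + b * hook k.-1 D).
split.
- by do !apply: symFD; apply: symFZ; first [exact: symF_two_row_defect | exact: symF_hook].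
- rewrite !totalD !totalZ !total_hook total_two_row_defect // bin1 binSn mulnDl.
  case: k {k3 lei leq1 leq2 leb} k0 => // k _.
  by rewrite bin_pred2 addnA.
move=> D sD; apply: leq_trans (beta_ge _ _ sD); apply: leq_trans (leq_addr _ _).
have : i * two_row_defect D <= i * (hook 1 D + hook 2 D).
  by rewrite leq_mul2l leq_subr orbT.
move: (two_row_defect D) => t; rewrite /hook.
move: (count_size id D); rewrite sD => cD.
have binq : 'C(k.+1, k) = k.+1 by rewrite binSn.
have binb : 'C(k.+1, k.-1) = 'C(k.+1, 2).
  by case: k k0 {k3 lei leb leq1 leq2 sD cD binq} => // k _; rewrite bin_pred2.
have iC : i <= 'C(k.+1, 2) by have := bin2K k.+1; nia.
have := bin1 k.+1; have := bin0 k.+1; have := binn k.+1.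
move: (count id D) cD => m cD.
have [->|m0] := eqVneq m 0; first by lia.
have [->|m1] := eqVneq m 1; first by lia.
have [->|mK] := eqVneq m k.+1; first by lia.
have [->|mk] := eqVneq m k; first by rewrite binq; lia.
have [->|m2] := eqVneq m 2; first by lia.
have [->|mk1] := eqVneq m k.-1; first by rewrite binb; lia.
lia.
Qed.

(** For n = 5, s_(3,2), s_(3,1,1) and s_(2,1,1,1) have sizes 5, 6 and 4; the values up to (5! - 2)/2
    = 59 are found by exhaustion. *)
Lemma reserved4 p : 8 <= p -> p <= 59 -> reserved 4 p.
Proof.
move=> ge8 le59.
pose triples := [seq (x.1, x.2, y) | x <- [seq (j, a) | j <- iota 0 4, a <- iota 0 7],
                                     y <- iota 0 5].
pose val3 (x : nat * nat * nat) := x.1.1 * 5 + x.1.2 * 6 + x.2 * 4.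
have /allP/(_ p) : all (fun p => has (fun x => val3 x == p) triples) (iota 8 52).
  by vm_compute.
rewrite mem_iota ge8 ltnS le59 => /(_ isT) /hasP[x /allpairsP[[ja q]]].
move=> [/allpairsP[[j a] [lej lea ->]] leq ->] /eqP <-.
have := @reserved_seed 3 j a 0 q.
rewrite !mem_iota /= in lej lea leq *.
rewrite /val3 /= (_ : 'C(4, 2) = 6) // mul0n addn0; apply=> //; lia.
Qed.

(* Euclidean division gives p = (k+t)C - (k-r) + q(k+1) with C = 'C(k.+1, 2); each
   copy of s_(n-2,2) has size C - 1. *)
Lemma reserved_small k p : 3 < k ->
    k * ('C(k.+1, 2)).-1 <= p ->
    p < k.+2 * (k.-1 * ('C(k, 2)).-1) + k * 'C(k.+1, 2) + k.+1 ->
  reserved k.+1 p.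
Proof.
move=> k3 lep ltp.
have C2 := bin2K k.+1; have C2' := bin2K k; rewrite [k.+1.-1]/= in C2.
have CS : 'C(k.+1, 2) = 'C(k, 2) + k by rewrite binS bin1.
set C := 'C(k.+1, 2) in lep ltp C2 CS *; set C0 := 'C(k, 2) in ltp C2' CS.
have C0' : C0 = C - k by lia.
pose p' := p + k - k * C.
have leC : C <= k.+1 * k.+1 by clear -C2; nia.
have C0_gt0 : 0 < C0 by rewrite bin_gt0; lia.
have C_gt0 : 0 < C by lia.
have lekC : k * C <= p + k by rewrite -(prednK C_gt0) mulnS addnC leq_add2r.
have p'K : p' + k * C = p + k by rewrite /p' subnK.
pose t := p' %/ C; pose s := p' %% C; pose q := s %/ k.+1; pose r := s %% k.+1.
have p'E : p' = t * C + s by exact: divn_eq.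
have sE : s = q * k.+1 + r by exact: divn_eq.
have lts : s < C by rewrite ltn_mod.
have ltr : r < k.+1 by rewrite ltn_mod.
have leq : q <= k.+1.
  rewrite -(leq_pmul2r (ltn0Sn k)); apply: leq_trans (leq_addr r _) _.
  by rewrite -sE; apply: leq_trans (ltnW lts) leC.
have lek2C : k <= 2 * C by rewrite C2 mulSn leq_addr.
(* Otherwise t > 2C - k = k^2, against the upper bound on p. *)
have let_ : t + k <= 2 * C.
  rewrite leqNgt; apply/negP => ltt.
  have : (2 * C - k + 1) * C <= t * C by rewrite leq_mul2r; apply/orP; right; clear -ltt lek2C; lia.
  rewrite C2; move: ltp p'K p'E C2 CS; rewrite -(prednK C0_gt0) /=.
  rewrite -(subnK k3); move: (k - 4) (C0.-1) => m C1.
  rewrite !addnS addn0 /= => ltp p'K p'E C2 CS.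
  have -> : m.+1.+4 * m.+4 - m.+4 + 0 = m.+4 * m.+4 by rewrite mulSn; clear; lia.
  clearbody r q s t p' C0 C; subst C => ltC.
  have : 2 * (m.+1 * C1) = m.+1 * (m.+2 * m.+1.+4) by rewrite mulnCA; congr (_ * _); clear -C2; nia.
  clear -ltC ltp p'K p'E; nia.
(* The t + r hooks of size C are split between [hook 2] and [hook k.-1], at most C of each. *)
pose a := minn (t + r) C.
have := @reserved_seed k (k - r) a (t + r - a) q (ltnW k3).
rewrite k3 -/C.
have -> : (k - r) * C.-1 + a * C + (t + r - a) * C + q * k.+1 = p.
  have lea : a <= t + r by rewrite geq_minl.
  have e1 : a * C + (t + r - a) * C = t * C + r * C by rewrite -!mulnDl subnKC.
  have e2 : (k - r) * C.-1 + (k - r) = (k - r) * C.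
    by rewrite -[X in _ = _ * X](prednK C_gt0) mulnS addnC.
  have e3 : (k - r) * C + r * C = k * C by rewrite -mulnDl subnK.
  clear -e1 e2 e3 p'K p'E sE ltr; clearbody a q r s t C p'.
  move: e1 e2 e3 p'K p'E sE; move: (a * C) (_ * C) (t * C) (r * C) (_ * C.-1).
  move: (_ * C) (k * C) (q * _); lia.
have [leaC lebC] : a <= C /\ t + r - a <= C.
  by rewrite /a; clear -ltr let_; clearbody r t C; lia.
by apply=> //; apply: leq_subr.
Qed.

Lemma reserved_large k p : 2 < k ->
  k * ('C(k.+1, 2)).-1 <= p -> 2 * p + 2 <= (k.+2)`! -> reserved k.+1 p.
Proof.
elim: k p => // k IH p k2 lep lep2.
have [k3|] := ltnP 2 k; last first.
  move=> lek; have {k2 lek} k2 : k = 2 by lia.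
  by subst k; apply: reserved4; [move: lep; rewrite (_ : 'C(4, 2) = 6) //; lia
                                | move: lep2; rewrite (_ : 5`! = 120) //; lia].
(* The threshold is n = k.+3 times the least value treated for n - 1, plus k.+1 hooks of size C,
   plus the largest residue k.+2. *)
have [|gep] := ltnP p (k.+3 * (k * ('C(k.+1, 2)).-1) + k.+1 * 'C(k.+2, 2) + k.+2).
  exact: reserved_small.
set C := 'C(k.+2, 2) in lep gep *.
pose q := (p - k.+1 * C) %/ k.+3; pose r := (p - k.+1 * C) %% k.+3.
have pE : p = q * k.+3 + r + k.+1 * C.
  rewrite /q /r -divn_eq subnK //; apply: leq_trans gep.
  by rewrite -addnA addnCA leq_addr.
have ltr : r < k.+3 by rewrite ltn_mod.
have ltkC : k < C by rewrite /C binS bin1 addnS ltnS leq_addl.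
have C_gt0 : 0 < C by apply: leq_trans ltkC.
clearbody q r.
have lq : k * ('C(k.+1, 2)).-1 <= q.
  rewrite -(leq_pmul2l (ltn0Sn k.+2)) (mulnC k.+3 q).
  clear -gep pE ltr; move: gep; rewrite pE.
  by move: (k.+3 * _) (q * _) (_ * C) => x y z; lia.
have uq : 2 * q + 2 <= (k.+2)`!.
  rewrite -(leq_pmul2l (ltn0Sn k.+2)); apply: leq_trans lep2.
  have : k.+1 * 2 <= k.+1 * C by rewrite leq_mul2l /=; clear -ltkC k3; clearbody C; lia.
  rewrite pE mulnDr mulnCA (mulnC k.+3 q); clear.
  by move: (q * _) (_ * C) => y z; lia.
have {IH} resq := IH q k3 lq uq.
have [r0|r_gt0] := posnP r.
  have := reserved_mulh1 _ _ 0 0 k2 resq (leq0n _) (leq0n _).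
  by rewrite -/C subn0 !mul0n !addn0 pE r0 addn0 mulnC.
(* The extra hook of size k.+2 overshoots r by k.+2 - r, which as many exchanges correct; r > 0
   keeps them within k.+1. *)
have := reserved_mulh1 _ _ (k.+2 - r) 1 k2 resq.
rewrite -/C.
have -> : k.+3 * q + ((k.+1 - (k.+2 - r)) * C + (k.+2 - r) * C.-1 + 1 * k.+2) = p.
  have eqC : (k.+2 - r) * C.-1 + (k.+2 - r) = (k.+2 - r) * C.
    by rewrite -[X in _ = _ * X](prednK C_gt0) mulnS addnC.
  have eqC2 : (k.+1 - (k.+2 - r)) * C + (k.+2 - r) * C = k.+1 * C.
    by rewrite -mulnDl subnK //; clear -r_gt0; lia.
  rewrite mulnC mul1n pE -eqC2 -eqC; clear -ltr.
  by move: (q * _) (_ * C) (_ * C.-1) => x y z; lia.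
apply=> //; clear -r_gt0; lia.
Qed.

Lemma admissible_small k p : 3 < k ->
  k.+1 * k.-1 <= p -> p < k * ('C(k.+1, 2)).-1 -> admissible k.+1 p.
Proof.
move=> k3 lep ltp.
have C2 := bin2K k.+1; rewrite [k.+1.-1]/= in C2; set C := 'C(k.+1, 2) in ltp C2.
have C_gt0 : 0 < C by nia.
have [lt1|ge1] := ltnP p (k.+1 * k).-1.
  (* Among k.-1 copies of s_(n-1,1), r are replaced by X, which is larger by 1. *)
  pose r := p - k.+1 * k.-1.
  have := @admissible_seed k r (k.-1 - r) 0 0 k3.
  rewrite mul0n !addn0 (_ : r * k.+2 + _ = p).
    by apply; nia.
  rewrite -addn1 mulnDr muln1 (mulnC r) (mulnC _ k.+1) addnAC -mulnDr subnKC; nia.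
have [lt2|ge2] := ltnP p (k.+1 * k).
  (* The single value k(k+1) - 1 = (C - 1) + C. *)
  have := @reserved_seed k 1 1 0 0 (ltnW k3).
  rewrite k3 -/C (_ : _ + _ = p); last by lia.
  by move=> res; apply/reserved_admissible/res => //; lia.
(* With k copies of s_(n-1,1), r of them replaced by X, the size is k(k+1) + r; b copies of
   s_(3,1^(n-3)) and q of s_(2,1^(n-2)) fill the rest. *)
pose b := (p - k.+1 * k) %/ C; pose s := (p - k.+1 * k) %% C.
pose q := s %/ k.+1; pose r := s %% k.+1.
have pE : p = b * C + s + k.+1 * k by rewrite /b /s -divn_eq subnK.
have sE : s = q * k.+1 + r by exact: divn_eq.
have lts : s < C by rewrite ltn_mod.
have ltr : r < k.+1 by rewrite ltn_mod.
have leC : C <= k.+1 * k.+1 by clear -C2; nia.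
have leq : q <= k.+1.
  rewrite -(leq_pmul2r (ltn0Sn k)); apply: leq_trans (leq_addr r _) _.
  by rewrite -sE; apply: leq_trans (ltnW lts) leC.
have leb : b <= C.
  apply: leq_trans (_ : k <= C); last by clear -C2 k3; nia.
  rewrite -(leq_pmul2r C_gt0); apply: leq_trans (leq_divM _ _) _.
  apply: leq_trans (leq_subr _ _) (leq_trans (ltnW ltp) _).
  by rewrite leq_mul2l leq_pred orbT.
have sizeE : r * k.+2 + (k - r + q) * k.+1 + b * C = p.
  have e1 : r * k.+1 + (k - r) * k.+1 = k.+1 * k by rewrite -mulnDl subnKC // mulnC.
  rewrite pE sE -e1 mulnS mulnDl.
  by move: (r * _) ((k - r) * _) (q * _) (b * _) => x y z t; lia.
rewrite -sizeE; apply: admissible_seed => //.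
by rewrite subnKC // ltnW.
Qed.

(** For n = 4, s_(3,1) and s_(2,1,1) have size 3 and s_(2,2) has size 2. *)
Lemma admissible3 p : 3 <= p -> p <= 11 -> admissible 3 p.
Proof.
move=> ge3 le11.
have seed a b j : a <= 3 -> b <= 3 -> j <= 2 -> admissible 3 (3 * (a + b) + 2 * j).
  move=> lea leb lej.
  exists (fun D => a * hook 1 D + b * hook 2 D + j * two_row D); split.
  - by do !apply: symFD; apply: symFZ; first [exact: symF_two_row | exact: symF_hook].
  - by rewrite !totalD !totalZ !total_hook total_two_row // -mulnDl mulnC (mulnC j).
  move=> D sD; apply: leq_trans (beta_ge _ _ sD).
  have : j * two_row D <= 2 * two_row D by rewrite leq_mul2r lej orbT.
  rewrite /hook; move: (count_size id D) (j * _) (2 * _); rewrite sD.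
  move=> cD x y; have C32 : 'C(3, 2) = 3 by [].
  move: (count id D) cD => m cD.
  have [->|m1] := eqVneq m 1; first by rewrite bin1; lia.
  have [->|m2] := eqVneq m 2; first by rewrite C32; lia.
  have [->|m0] := eqVneq m 0; first by rewrite bin0; lia.
  have [->|m3] := eqVneq m 3; first by rewrite binn; lia.
  lia.
have [j [a [-> lej lea]]] : exists j a, [/\ p = 3 * a + 2 * j, j <= 2 & a <= 6].
  pose pairs := [seq (j, a) | j <- iota 0 3, a <- iota 0 7].
  have /allP/(_ p) : all (fun p => has (fun x => 3 * x.2 + 2 * x.1 == p) pairs) (iota 3 9).
    by vm_compute.
  rewrite mem_iota ge3 ltnS le11 => /(_ isT) /hasP[_ /allpairsP[[j a] [lej lea ->]] /eqP <-].
  by rewrite !mem_iota /= in lej lea; exists j, a.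
have -> : a = minn a 3 + (a - 3) by lia.
by apply: seed; lia.
Qed.

Theorem theorem1p1 (n p : nat) :
  4 <= n ->
  (n - 1) * (n - 3) <= p ->
  p <= (n`! - 2) %/ 2 ->
  exists S : {set {perm 'I_n}},
    [/\ symmetric_set S, #|S| = p, (1%g : {perm 'I_n}) \notin S & delta n \notin S].
Proof.
case: n => [|[|[|[|k]]]] // _; rewrite subn1 -(addn3 k.+1) addnK addn3 => lep lep2.
apply: admissible_set => //.
have {}lep2 : 2 * p + 2 <= (k.+4)`!.
  (* Positivity of p shows that the subtraction in n! - 2 is not truncated. *)
  have p_gt0 : 0 < p by apply: leq_trans lep.
  by move: lep2; move: (factorial _) => m; lia.
case: k lep lep2 => [|[|k]] lep lep2.
- by apply: admissible3 => //; move: lep2; rewrite (_ : 4`! = 24) //; lia.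
- by apply/reserved_admissible/reserved4 => //; move: lep2; rewrite (_ : 5`! = 120) //; lia.
have [ltp|gep] := ltnP p (k.+4 * ('C(k.+4.+1, 2)).-1).
  exact: admissible_small.
exact/reserved_admissible/reserved_large.
Qed.
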